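(* Let $(\mathfrak{g},[\cdot,\cdot]_\mathfrak{g},N)$ be a Nijenhuis Lie algebra and $(\mathcal{V},\rho,S)$ a Nijenhuis representation of it. Then the quadruple $(\mathcal{V},l,r,\psi)$ is a representation of the induced NS-Lie algebra $(\mathfrak{g},\diamond_N,\lfloor\cdot,\cdot\rfloor_N)$, where $$l_x(v)=\rho_{N(x)}v,\qquad r_x(v)=-\rho_xS(v),\qquad\psi_x(v)=-S(\rho_xv),\qquad x\in\mathfrak{g},\ v\in\mathcal{V}.$$
   Context: A Nijenhuis Lie algebra $(\mathfrak{g},[\cdot,\cdot]_\mathfrak{g},N)$ is a Lie algebra with a linear map $N$ satisfying $[Nx,Ny]_\mathfrak{g}=N([Nx,y]_\mathfrak{g}+[x,Ny]_\mathfrak{g}-N[x,y]_\mathfrak{g})$. A Nijenhuis representation of it is $(\mathcal{V},\rho,S)$ with $(\mathcal{V},\rho)$ a Lie algebra representation and $S:\mathcal{V}\to\mathcal{V}$ linear with $\rho_{Nx}S(v)=S(\rho_{Nx}v+\rho_xS(v)-S(\rho_xv))$. An NS-Lie algebra $(\mathfrak{p},\diamond,\lfloor\cdot,\cdot\rfloor)$ is a vector space with bilinear operations $\diamond$ and $\lfloor\cdot,\cdot\rfloor$, the latter antisymmetric, such that, with $\llbracket x,y\rrbracket:=x\diamond y-y\diamond x+\lfloor x,y\rfloor$, $(x\diamond y)\diamond z-x\diamond(y\diamond z)+\lfloor x,y\rfloor\diamond z=(y\diamond x)\diamond z-y\diamond(x\diamond z)$ and $\lfloor x,\llbracket y,z\rrbracket\rfloor+\lfloor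 y,\llbracket z,x\rrbracket\rfloor+\lfloor z,\llbracket x,y\rrbracket\rfloor+x\diamond\lfloor y,z\rfloor+y\diamond\lfloor z,x\rfloor+z\diamond\lfloor x,y\rfloor=0$. A Nijenhuis Lie algebra induces the NS-Lie algebra $(\mathfrak{g},\diamond_N,\lfloor\cdot,\cdot\rfloor_N)$ with $x\diamond_Ny=[N(x),y]_\mathfrak{g}$, $\lfloor x,y\rfloor_N=-N[x,y]_\mathfrak{g}$. A representation of an NS-Lie algebra $(\mathfrak{p},\diamond,\lfloor\cdot,\cdot\rfloor)$ is a vector space $\mathcal{V}$ with linear maps $l,r,\psi:\mathfrak{p}\to\mathrm{End}(\mathcal{V})$ such that for all $x,y\in\mathfrak{p}$: $l_{x\diamond y}-l_xl_y+l_{\lfloor x,y\rfloor}=l_{y\diamond x}-l_yl_x$; $r_{x\diamond y}-r_yr_x+r_y\psi_x=l_xr_y-r_yl_x$; $\psi_{\llbracket x,y\rrbracket}-r_{\lfloor x,y\rfloor}=l_x\psi_y-l_y\psi_x+\psi_x(l_y-r_y+\psi_y)-\psi_y(l_x-r_x+\psi_x)$. *)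

(* Defs.v *)
From mathcomp Require Import all_boot all_order all_algebra.

Set Implicit Arguments.
Unset Strict Implicit.
Unset Printing Implicit Defensive.

Import GRing.Theory.
Local Open Scope ring_scope.

(* The ground field is arbitrary and vector spaces may be infinite-dimensional.
   A linear map V -> End(W) is encoded as a bilinear map V -> W -> W, and
   identities in End(W) are stated pointwise. *)

Record lieAlgebra (k : fieldType) (g : lmodType k) := LieAlgebra {
  lie_bracket :> {bilinear g -> g -> g};
  lie_alternating : forall x, lie_bracket x x = 0;
  lie_jacobi : forall x y z,
    lie_bracket x (lie_bracket y z) + lie_bracket y (lie_bracket z x)
      + lie_bracket z (lie_bracket x y) = 0
}.

Definition nijenhuis_operator (k : fieldType) (g : lmodType k)
    (br : lieAlgebra g) (N : {linear g -> g}) : Prop :=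
  forall x y, br (N x) (N y) = N (br (N x) y + br x (N y) - N (br x y)).

Record lieRepresentation (k : fieldType) (g : lmodType k) (br : lieAlgebra g)
    (V : lmodType k) := LieRepresentation {
  lie_action :> {bilinear g -> V -> V};
  lie_action_bracket : forall x y v,
    lie_action (br x y) v
      = lie_action x (lie_action y v) - lie_action y (lie_action x v)
}.

Definition nijenhuis_representation (k : fieldType) (g : lmodType k)
    (br : lieAlgebra g) (N : {linear g -> g}) (V : lmodType k)
    (rho : lieRepresentation br V) (S : {linear V -> V}) : Prop :=
  forall x v,
    rho (N x) (S v) = S (rho (N x) v + rho x (S v) - S (rho x v)).

Definition ns_bracket (k : fieldType) (p : lmodType k) (dia flo : p -> p -> p)
    (x y : p) : p :=
  dia x y - dia y x + flo x y.

Record nsLieAlgebra (k : fieldType) (p : lmodType k) := NSLieAlgebra {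
  ns_dia : p -> p -> p;
  ns_flo : p -> p -> p;
  ns_dia_bilinear : bilinear_for *:%R *:%R ns_dia;
  ns_flo_bilinear : bilinear_for *:%R *:%R ns_flo;
  ns_flo_antisym : forall x y, ns_flo x y = - ns_flo y x;
  ns_axiom1 : forall x y z,
    ns_dia (ns_dia x y) z - ns_dia x (ns_dia y z) + ns_dia (ns_flo x y) z
      = ns_dia (ns_dia y x) z - ns_dia y (ns_dia x z);
  ns_axiom2 : forall x y z,
    ns_flo x (ns_bracket ns_dia ns_flo y z)
      + ns_flo y (ns_bracket ns_dia ns_flo z x)
      + ns_flo z (ns_bracket ns_dia ns_flo x y)
      + ns_dia x (ns_flo y z) + ns_dia y (ns_flo z x) + ns_dia z (ns_flo x y)
      = 0
}.

Record ns_representation (k : fieldType) (p : lmodType k) (A : nsLieAlgebra p)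
    (V : lmodType k) (l r psi : p -> V -> V) : Prop := NSRepresentation {
  ns_rep_l_bilinear : bilinear_for *:%R *:%R l;
  ns_rep_r_bilinear : bilinear_for *:%R *:%R r;
  ns_rep_psi_bilinear : bilinear_for *:%R *:%R psi;
  ns_rep_axiom1 : forall x y v,
    l (ns_dia A x y) v - l x (l y v) + l (ns_flo A x y) v
      = l (ns_dia A y x) v - l y (l x v);
  ns_rep_axiom2 : forall x y v,
    r (ns_dia A x y) v - r y (r x v) + r y (psi x v)
      = l x (r y v) - r y (l x v);
  ns_rep_axiom3 : forall x y v,
    psi (ns_bracket (ns_dia A) (ns_flo A) x y) v - r (ns_flo A x y) v
      = l x (psi y v) - l y (psi x v)
        + psi x (l y v - r y v + psi y v) - psi y (l x v - r x v + psi x v)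
}.

Section InducedNSLieAlgebra.

Variables (k : fieldType) (g : lmodType k) (br : lieAlgebra g).
Variables (N : {linear g -> g}) (hN : nijenhuis_operator br N).

Definition nijenhuis_dia (x y : g) : g := br (N x) y.
Definition nijenhuis_flo (x y : g) : g := - N (br x y).

Lemma lie_antisym x y : br x y = - br y x.
Proof.
apply/eqP; rewrite -addr_eq0; apply/eqP.
have := lie_alternating br (x + y).
by rewrite linearDl /= !linearDr /= !lie_alternating add0r addr0.
Qed.

Lemma lie_derivation x y z : br x (br y z) = br (br x y) z + br y (br x z).
Proof.
apply/eqP; rewrite -subr_eq0; apply/eqP.
rewrite -(lie_jacobi br x y z) [br z x]lie_antisym [br z (br x y)]lie_antisym.
by rewrite linearNr /= opprD addrA addrAC.
Qed.

Lemma nijenhuis_dia_bilinear : bilinear_for *:%R *:%R nijenhuis_dia.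
Proof.
split=> u a x y; rewrite /nijenhuis_dia /=.
  by rewrite linearP linearPl.
by rewrite linearPr.
Qed.

Lemma nijenhuis_flo_bilinear : bilinear_for *:%R *:%R nijenhuis_flo.
Proof.
split=> u a x y; rewrite /nijenhuis_flo /=.
  by rewrite linearPl linearP opprD scalerN.
by rewrite linearPr linearP opprD scalerN.
Qed.

Lemma nijenhuis_flo_antisym x y : nijenhuis_flo x y = - nijenhuis_flo y x.
Proof. by rewrite /nijenhuis_flo lie_antisym linearN. Qed.

Lemma nijenhuis_axiom1 x y z :
  nijenhuis_dia (nijenhuis_dia x y) z - nijenhuis_dia x (nijenhuis_dia y z)
    + nijenhuis_dia (nijenhuis_flo x y) z
  = nijenhuis_dia (nijenhuis_dia y x) z - nijenhuis_dia y (nijenhuis_dia x z).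
Proof.
rewrite /nijenhuis_dia /nijenhuis_flo (lie_derivation (N x)) hN.
rewrite [br (N y) x]lie_antisym !linearB !linearD !linearN /=.
rewrite !linearBl !linearDl !linearNl /=.
set a := br (N (br (N x) y)) z; set b := br (N (br x (N y))) z.
set c := br (N (N _)) z; set d := br (N y) _.
by rewrite !opprD opprK !addrA subrr add0r addrAC addrK.
Qed.

Lemma nijenhuis_axiom2 x y z :
  nijenhuis_flo x (ns_bracket nijenhuis_dia nijenhuis_flo y z)
    + nijenhuis_flo y (ns_bracket nijenhuis_dia nijenhuis_flo z x)
    + nijenhuis_flo z (ns_bracket nijenhuis_dia nijenhuis_flo x y)
    + nijenhuis_dia x (nijenhuis_flo y z) + nijenhuis_dia y (nijenhuis_flo z x)
    + nijenhuis_dia z (nijenhuis_flo x y) = 0.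
Proof.
have flodia u v w :
    nijenhuis_flo u (ns_bracket nijenhuis_dia nijenhuis_flo v w)
      + nijenhuis_dia u (nijenhuis_flo v w)
    = - N (br u (br (N v) w) + br u (br v (N w)) + br (N u) (br v w)
           - N (br u (br v w))).
  rewrite /nijenhuis_flo /ns_bracket /nijenhuis_dia linearNr /= hN -opprD.
  rewrite -linearD /= [br (N w) v]lie_antisym opprK linearBr linearDr /=.
  congr (- N _); set a := br u (br (N v) w); set b := br u (br v (N w)).
  set c := br u (N _); set d := br (N u) _.
  by rewrite -!addrA; congr (a + (b + _)); rewrite addrCA addKr.
set X := nijenhuis_flo x _; set Y := nijenhuis_flo y (ns_bracket _ _ _ _).
set Z := nijenhuis_flo z (ns_bracket _ _ _ _).
set X' := nijenhuis_dia x _; set Y' := nijenhuis_dia y _.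
set Z' := nijenhuis_dia z _.
have -> : X + Y + Z + X' + Y' + Z' = (X + X') + (Y + Y') + (Z + Z').
  by rewrite (AC (1*1*1*1*1*1) ((1*4)*(2*5)*(3*6))).
rewrite !flodia -!opprD -!(linearD N) -[RHS]oppr0 -[in RHS](linear0 N).
congr (- N _).
have Jx := lie_jacobi br (N x) y z.
have Jy := lie_jacobi br x (N y) z.
have Jz := lie_jacobi br x y (N z).
have J : N (br x (br y z)) + N (br y (br z x)) + N (br z (br x y)) = 0.
  by rewrite -!linearD /= lie_jacobi linear0.
move: Jx Jy Jz J.
set a1 := br (N x) _; set a2 := br y (br z (N x)); set a3 := br z (br (N x) y).
set b1 := br x (br (N y) z); set b2 := br (N y) _; set b3 := br z (br x (N y)).
set c1 := br x (br y (N z)); set c2 := br y (br (N z) x); set c3 := br (N z) _.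
set n1 := N (br x _); set n2 := N (br y _); set n3 := N (br z _).
move=> Jx Jy Jz J.
rewrite [LHS](_ : _ = (a1 + a2 + a3) + (b1 + b2 + b3) + (c1 + c2 + c3)
                     - (n1 + n2 + n3)); last first.
  rewrite !opprD.
  by rewrite (AC ((1*1*1*1)*(1*1*1*1)*(1*1*1*1))
    ((3*6*9)*(1*7*10)*(2*5*11)*(4*8*12))).
by rewrite Jx Jy Jz J oppr0 !addr0.
Qed.

Definition induced_nsLieAlgebra : nsLieAlgebra g :=
  NSLieAlgebra nijenhuis_dia_bilinear nijenhuis_flo_bilinear
    nijenhuis_flo_antisym nijenhuis_axiom1 nijenhuis_axiom2.

End InducedNSLieAlgebra.

(* Main.v *)
Require Import Defs.
From mathcomp Require Import all_boot all_order all_algebra.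

Set Implicit Arguments.
Unset Strict Implicit.
Unset Printing Implicit Defensive.

Import GRing.Theory.
Local Open Scope ring_scope.

(** The maps [l], [r], [psi] are the mixed components of the NS-Lie operations
    that the Nijenhuis operator [N + S] induces on the semidirect product of
    the Lie algebra with [V], so the three axioms are the mixed components of
    the NS-Lie axioms there. They can also be checked directly, each for one
    reason:
    - axiom 1 is the Nijenhuis identity of [N], transported by the action
      ([action_nijenhuis_bracket]);
    - axiom 2, once the action of [[N x, y]] is written as a commutator, is the
      Nijenhuis identity of [S] at [x] to which the action of [y] is applied;
    - axiom 3 uses the Nijenhuis identity of [S] for the actions of [[x, y]],
      [x] and [y]. After that every term is in the image of [S], and what
      remains under [S] is the commutator rule for the actions of [[N x, y]],
      [[x, N y]] and [[x, y]]. *)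

Section NijenhuisRepresentation.

Variables (k : fieldType) (g : lmodType k) (br : lieAlgebra g).
Variables (V : lmodType k) (rho : lieRepresentation br V).

Lemma action_nijenhuis_bracket (N : {linear g -> g})
    (hN : nijenhuis_operator br N) x y v :
  rho (N (br (N x) y)) v + rho (N (br x (N y))) v - rho (N (N (br x y))) v
    = rho (N x) (rho (N y) v) - rho (N y) (rho (N x) v).
Proof.
by rewrite -lie_action_bracket hN linearB linearD /= linearBl linearDl.
Qed.

(** One statement gives the bilinearity of all three maps: [l], [- r] and
    [- psi] arise when two of [f], [S], [T] are the identity. *)
Lemma action_comp_bilinear (f : {linear g -> g}) (S T : {linear V -> V}) :
  bilinear_for *:%R *:%R (fun x v => S (rho (f x) (T v))).
Proof.
split=> u a x y /=; first by rewrite linearP linearPl linearP.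
by rewrite linearP linearPr linearP.
Qed.

Lemma bilinear_forN (l : g -> V -> V) :
  bilinear_for *:%R *:%R l -> bilinear_for *:%R *:%R (fun x v => - l x v).
Proof.
case=> hl hr; split=> u a x y /=.
  by rewrite (hl u a x y) opprD scalerN.
by rewrite (hr u a x y) opprD scalerN.
Qed.

End NijenhuisRepresentation.

Theorem proposition6p24 (k : fieldType) (g : lmodType k) (br : lieAlgebra g)
    (N : {linear g -> g}) (hN : nijenhuis_operator br N)
    (V : lmodType k) (rho : lieRepresentation br V) (S : {linear V -> V})
    (hS : nijenhuis_representation N rho S) :
  ns_representation (induced_nsLieAlgebra hN)
    (fun x v => rho (N x) v)
    (fun x v => - rho x (S v))
    (fun x v => - S (rho x v)).
Proof.
split.
- exact: (action_comp_bilinear rho N idfun idfun).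
- exact/bilinear_forN/(action_comp_bilinear rho idfun idfun S).
- exact/bilinear_forN/(action_comp_bilinear rho idfun S idfun).
- move=> x y v /=; rewrite /nijenhuis_dia /nijenhuis_flo.
  (* As [[N y, x]] = - [[x, N y]], the three images under N become the summands
     of the Nijenhuis identity. *)
  rewrite [br (N y) x]lie_antisym !linearN /= !linearNl /=.
  have := action_nijenhuis_bracket rho hN x y v.
  set a := rho (N (br (N x) y)) v; set b := rho (N (br x _)) v.
  set c := rho (N (N _)) v; set p := rho (N x) _; set q := rho (N y) _.
  move=> abc; apply/eqP; rewrite -subr_eq0; apply/eqP.
  have -> : a - p - c - (- b - q) = (a + b - c) - (p - q).
    by rewrite !opprD !opprK (AC (3*2) ((1*4*3)*(2*5))).
  by rewrite abc subrr.
- move=> x y v /=; rewrite /nijenhuis_dia.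
  rewrite lie_action_bracket hS !(linearN S) !linearNr /= !opprK.
  rewrite (linearB S) (linearD S) linearBr linearDr /=.
  set p := rho (N x) _; set q := rho y (S (rho (N x) v)).
  set s := rho y (S (rho x (S v))); set t := rho y (S (S _)).
  have -> : - (p - (q + s - t)) - s + t = (- p + q) + (s - s) + (t - t).
    by rewrite !opprD !opprK (AC ((1*3)*1*1) ((1*2)*(3*5)*(6*4))).
  by rewrite !subrr !addr0.
- move=> x y v /=.
  rewrite /ns_bracket /nijenhuis_dia /nijenhuis_flo [br (N y) x]lie_antisym.
  rewrite !opprK 2!linearDl !linearNl !linearNr /= !hS !opprK.
  (* Both sides are now sums of values of S; the arguments already agree. *)
  rewrite -!(linearN S) -!(linearD S) /=; congr (S _).
  rewrite !lie_action_bracket !linearDr /= !(linearN S) !linearNr /= (linearB S) /=.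
  set a := rho (N x) (rho y v); set b := rho (N y) (rho x v).
  set c := rho x (rho (N y) v); set d := rho y (rho (N x) v).
  set n := rho (N (br x y)) v.
  set e := rho x (rho y (S v)); set f := rho y (rho x (S v)).
  set p := rho x (S (rho y v)); set q := rho y (S (rho x v)).
  set h := S (rho x (rho y v)); set i := S (rho y (rho x v)).
  have -> : - (a - d + (c - b) - n) - (n + (e - f) - (h - i))
      = (- a + d - c + b) + (- e + f + h - i) + (n - n).
    rewrite !opprD !opprK.
    by rewrite (AC ((2*2*1)*(1*2*2)) ((1*2*3*4)*(7*8*9*10)*(5*6))).
  rewrite subrr addr0.
  have -> : - (a + p - h) + (b + q - i) - (c + e - p) + (d + f - q)
      = (- a + d - c + b) + (- e + f + h - i) + (p - p) + (q - q).
    rewrite !opprD !opprK.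
    by rewrite (AC (3*3*3*3)
      ((1*10*7*4)*(8*11*3*6)*(9*2)*(5*12))).
  by rewrite !subrr !addr0.
Qed.
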